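(* For every positive integer $n$, $\big|\mathcal{A}^\circ_n(2431; 1324)\big| = P_{n-1}$, where $(P_m)_{m\ge 0}$ is the Pell sequence defined by $P_0=0$, $P_1=1$ and $P_m=2P_{m-1}+P_{m-2}$ for $m\geq 2$.
   Context: Let $S_n$ be the symmetric group on $[n]=\{1,\dots,n\}$. A permutation $\pi\in S_n$ has one-line form $\pi_1\pi_2\cdots\pi_n$ with $\pi_i=\pi(i)$. For a word $w=w_1\cdots w_n$ of distinct integers and $\tau=\tau_1\cdots\tau_k\in S_k$, $w$ contains $\tau$ if there are indices $i_1<\cdots<i_k$ with $w_{i_s}>w_{i_t}$ iff $\tau_s>\tau_t$ for all $1\le s<t\le k$; otherwise $w$ avoids $\tau$. A permutation $\pi\in S_n$ is a cyclic (cycle) permutation if it consists of a single $n$-cycle $\pi=(c_1,c_2,\dots,c_n)$ (meaning $\pi(c_i)=c_{i+1}$ for $i<n$ and $\pi(c_n)=c_1$). Its cycle forms are the words $c_ic_{i+1}\cdots c_nc_1c_2\cdots c_{i-1}$ for $1\le i\le n$. For patterns $\sigma,\tau$, $\mathcal{A}^\circ_n(\sigma;\tau)$ denotes the set of cyclic permutations $\pi\in S_n$ whose one-line form avoids $\sigma$ and all of whose cycle forms avoid $\tau$. Convention used by the paper: for $n=1$ this set is taken to have cardinality $0$ (the paper asserts $|\mathcal{A}^\circ_1(2431;1324)|=0$). *)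

(* Defs.v *)
From mathcomp Require Import all_boot all_fingroup.

Set Implicit Arguments.
Unset Strict Implicit.
Unset Printing Implicit Defensive.

(* [f] is the sequence of positions i_1 < ... < i_k of an occurrence. *)
Definition contains (tau w : seq nat) : bool :=
  [exists f : {ffun 'I_(size tau) -> 'I_(size w)},
    [forall s : 'I_(size tau), forall t : 'I_(size tau), (s < t) ==>
      (f s < f t) &&
      ((nth 0 w (f s) > nth 0 w (f t)) == (nth 0 tau s > nth 0 tau t))]].

Definition avoids (tau w : seq nat) : bool := ~~ contains tau w.

(* S_n acts on 'I_n = {0, ..., n-1} rather than {1, ..., n}; letters of words
   are shifted by one, so that they range over {1, ..., n}. *)
Definition word n (c : seq 'I_n) : seq nat := [seq (val i).+1 | i <- c].

Definition one_line n (pi : 'S_n) : seq nat := word [seq pi i | i <- enum 'I_n].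

(* pi = (c_1, ..., c_n): pi c_i = c_(i+1) for i < n and pi c_n = c_1. *)
Definition is_cycle_of n (pi : 'S_n) (c : n.-tuple 'I_n) : bool :=
  uniq c && fcycle pi c.

Definition cyclic_perm n (pi : 'S_n) : bool :=
  [exists c : n.-tuple 'I_n, is_cycle_of pi c].

Definition cycle_forms n (c : n.-tuple 'I_n) : seq (seq nat) :=
  [seq word (rot i c) | i <- iota 0 n].

(* The condition 1 < n encodes the convention that the set is empty for n = 1,
   although the identity of S_1 is a 1-cycle. For n >= 2 it is vacuous. *)
Definition cyclic_avoiders n (sigma tau : seq nat) : {set 'S_n} :=
  [set pi : 'S_n | [&& 1 < n, cyclic_perm pi, avoids sigma (one_line pi) &
    [forall c : n.-tuple 'I_n,
      is_cycle_of pi c ==> all (avoids tau) (cycle_forms c)]]].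

Fixpoint pell (m : nat) : nat :=
  match m with
  | 0 => 0
  | 1 => 1
  | (m'.+1 as m1).+1 => 2 * pell m1 + pell m'
  end.

(* Main.v *)
Require Import Defs.
From mathcomp Require Import all_boot all_fingroup.
From mathcomp Require Import zify.

(* Shift letters to 0, ..., n-1, write the cycle as 0 :: w, and let p x be the
   position of x in it.  All cycle forms avoid 1324 iff w avoids 213 and 4132.
   Assuming this, counting arguments show that an occurrence of 2431 in the
   one-line form exists iff some a > 0 has pi (a + 1) = a + 2 < pi a.  Both
   conditions are hereditary under deleting the smallest letter v of w, and a
   word on the letters > v extends exactly by putting v at the end, at the front
   (unless v + 1 is immediately followed by v + 2 and is not in front), or just
   before v + 1 (if v + 1 is not in front).  If T counts the words and S those
   whose least letter is in front or followed by its successor, then T' = T + S'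
   and S' = 2 T - S, which is the Pell recursion for T. *)

(** * Inserting a smallest letter *)

Definition insat (i v : nat) (w : seq nat) : seq nat := take i w ++ v :: drop i w.

Lemma mem_insat (i v : nat) (w : seq nat) x : (x \in insat i v w) = (x == v) || (x \in w).
Proof. by rewrite -{2}(cat_take_drop i w) !mem_cat inE orbCA. Qed.

(** Also right for absent letters: their index is the size, which is at least [i] and grows by
    one. *)
Lemma index_insat (i v : nat) (w : seq nat) x : i <= size w -> x != v ->
  index x (insat i v w) = index x w + (i <= index x w).
Proof.
move=> le_iw xDv; rewrite -{2 3}(cat_take_drop i w) !index_cat /= size_takel //.
case: ifP => [x_w|_]; last by rewrite eq_sym (negPf xDv); lia.
by move: x_w; rewrite -index_mem size_takel //; lia.
Qed.

Lemma index_insat_eq (i v : nat) (w : seq nat) : i <= size w -> v \notin w ->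
  index v (insat i v w) = i.
Proof.
move=> le_iw vw; rewrite index_cat /= eqxx size_takel // addn0.
by rewrite (negPf (contra (@mem_take _ _ _ _) vw)).
Qed.

Lemma rem_insat (i v : nat) (w : seq nat) :
  i <= size w -> v \notin w -> rem v (insat i v w) = w.
Proof.
move=> le_iw vw; rewrite remE index_insat_eq // take_size_cat ?size_takel //.
by rewrite drop_cat size_takel // ltnNge leqnSn /= subSnn /= drop0 cat_take_drop.
Qed.

Lemma insat_index_rem (v : nat) (w : seq nat) : v \in w -> insat (index v w) v (rem v w) = w.
Proof.
move=> vw; have le_iw: index v w <= size w by rewrite index_size.
rewrite remE /insat take_size_cat ?size_takel // drop_size_cat ?size_takel //.
by rewrite -drop_index // cat_take_drop.
Qed.

Lemma perm_insat (i v : nat) (w : seq nat) m :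
  perm_eq (insat i v w) (iota v m.+1) = perm_eq w (iota v.+1 m).
Proof. by rewrite /insat -cat1s perm_catCA /= perm_cons cat_take_drop. Qed.

(* Letters outside [w] have index [size w], hence the single membership premise,
   on the last letter of the occurrence. *)
Definition avoids213 (w : seq nat) := forall x y z, z \in w -> x < y < z ->
  ~ (index y w < index x w < index z w).
Definition avoids4132 (w : seq nat) := forall x y z t, y \in w ->
  x < y < z -> z < t ->
  ~ (index t w < index x w < index z w /\ index z w < index y w).
(* With [b] the successor of [a] in the cycle 0 :: w, this forbids
   pi (a + 1) = a + 2 < pi a. *)
Definition avoids_jump_step (w : seq nat) := forall a b, b \in w -> a.+2 < b ->
  index b w = (index a w).+1 -> index a.+2 w <> (index a.+1 w).+1.
Definition good (w : seq nat) := [/\ avoids213 w, avoids4132 w & avoids_jump_step w].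

(** The obstruction to a smaller letter in front: [v.-1] put there would be followed by a letter
    above [v.+1] while [v] is followed by [v.+1], which is a forbidden jump. *)
Definition keeps (v : nat) (w : seq nat) :=
  (0 < index v w) && (index v.+1 w == (index v w).+1).

(* Positions where a letter smaller than [v], the least letter of [w], can go. *)
Definition slots (v : nat) (w : seq nat) : seq nat :=
  size w :: (if keeps v w then [::] else [:: 0])
         ++ (if index v w == 0 then [::] else [:: index v w]).

Lemma good_insat i v (w : seq nat) m : i <= size w -> perm_eq w (iota v.+1 m.+1) ->
  good (insat i v w) <-> good w /\ i \in slots v.+1 w.
Proof.
move=> le_iw Pw; have sw : size w = m.+1 by rewrite (perm_size Pw) size_iota.
have mw (x : nat) : (x \in w) = (v < x <= v.+1 + m) by rewrite (perm_mem Pw) mem_iota; lia.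
have Uw : uniq w by rewrite (perm_uniq Pw) iota_uniq.
have vw : v \notin w by rewrite mw; lia.
have iv := index_insat_eq _ _ _ le_iw vw.
have ix (x : nat) := index_insat _ v _ x le_iw.
have mi := mem_insat i v w.
have lw (x : nat) : (index x w < size w) = (v < x <= v.+1 + m) by rewrite index_mem.
have inj (x y : nat) : index x w = index y w -> v < x <= v.+1 + m -> x = y.
  move=> e; rewrite -mw => xw; rewrite -(nth_index 0 xw) e nth_index //.
  by rewrite -index_mem -e index_mem.
have at_ j : j < size w -> exists2 x, v < x <= v.+1 + m & index x w = j.
  by move=> lt_j; exists (nth 0 w j); rewrite -?mw ?mem_nth // index_uniq.
set w' := insat i v w in ix mi iv *.
have ix' (x : nat) : x != v -> (i <= index x w /\ index x w' = (index x w).+1) \/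
   (index x w < i /\ index x w' = index x w).
  by move=> /ix ->; case: leqP => _ ; lia.
have ltE x y : x != v -> y != v ->
    (index x w' < index y w') = (index x w < index y w).
  by move=> /ix-> /ix->; do 2!case: (leqP i); lia.
have ltvE x : x != v -> (i < index x w') = (i <= index x w).
  by move=> /ix->; case: leqP; lia.
have gtvE x : x != v -> (index x w' < i) = (index x w < i).
  by move=> /ix->; case: leqP; lia.
have succE x y : x != v -> y != v -> index y w' = (index x w').+1 <->
    index y w = (index x w).+1 /\ i <> index y w.
  by move=> /ix-> /ix->; do 2!case: (leqP i); lia.
have slotE : (i \in slots v.+1 w) <-> i = size w \/
    (i = 0 /\ ~~ keeps v.+1 w) \/ (i = index v.+1 w /\ 0 < i).
  rewrite /slots inE mem_cat.
  by case: keeps; case: (index _ _) => [|j]; rewrite /= ?in_nil ?inE ?mem_seq1; split=> H; lia.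
rewrite slotE.
split=> [[A3 A4 AK] | [[A3 A4 AK] Hi]].
(* Suppose [v] is neither first nor last; let [x] be the first letter and [y] the one right after
   [v], with [y] not [v.+1]. Then [y < x], else [x], [v], [y] is a 213; and [v.+1] comes after [y],
   else [v.+1], [v], [y] is a 213. So [x], [v], [y], [v.+1] is a 4132. *)
- have Hi : i = size w \/ i = 0 \/ (i = index v.+1 w /\ 0 < i).
    have [e | lt_iw] := eqVneq i (size w); first by left.
    have [e | i0] := eqVneq i 0; first by right; left.
    have [x hx qx] : exists2 x, v < x <= v.+1 + m & index x w = 0.
      by apply: at_; lia.
    have [y hy qy] : exists2 y, v < y <= v.+1 + m & index y w = i.
      by apply: at_; lia.
    right; right; split; last lia.
    have [e | yDv] := eqVneq y v.+1; first by rewrite -e qy.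
    have xDy : x <> y by move=> e; move: qx; rewrite e; lia.
    have lt_v1y : v.+1 < y by lia.
    have lt_yx : y < x.
      suff: ~ v < x < y by lia.
      move=> /(A3 v x y); rewrite mi mw iv gtvE ?ltvE ?qx ?qy; lia.
    have le_iv1 : i < index v.+1 w.
      have := A3 v v.+1 y; rewrite mi mw iv gtvE ?ltvE ?qy; try lia.
      have := inj y v.+1; lia.
    case: (A4 v v.+1 y x); rewrite ?mi ?mw ?iv; try lia.
    by rewrite gtvE ?ltvE ?ltE ?qx ?qy; lia.
  split; first split.
  + move=> x y z zw h1 h2.
    have h0 : v < x by have := lw x; rewrite mw in zw; have := lw z; lia.
    by apply: (A3 x y z); rewrite ?mi ?zw ?orbT // !ltE //; lia.
  + move=> x y z t yw h1 h2 h3.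
    have h0 : v < x by have := lw x; rewrite mw in yw; have := lw y; lia.
    by apply: (A4 x y z t); rewrite ?mi ?yw ?orbT // !ltE //; lia.
  (* An adjacency in [w] is lost only if [v] is inserted inside it, at the index of [b] or of
     [a.+2]. By [Hi] this cannot happen: both letters exceed [v.+1], occur in [w] and are not
     first. *)
  + move=> a b bw; rewrite mw in bw => h1 h2 h3.
    have h0 : v < a by have := lw a; have := lw b; lia.
    have := inj b v.+1; have := inj a.+2 v.+1; have := lw b; have := lw a.+2.
    move=> l1 l2 i1 i2.
    by apply: (AK a b) => //; [rewrite mi mw; lia | |]; apply/succE; lia.
  + case: Hi => [|[i0|]]; [by left| | by right; right].
    (* Were [v.+1] kept, the first letter [x] of [w] would follow [v] and exceed [v.+2]. *)
    right; left; split=> //; apply/negP=> /andP[k1 /eqP k2].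
    have [x hx qx] : exists2 x, v < x <= v.+1 + m & index x w = 0.
      by apply: at_; lia.
    have xDv1 : x <> v.+1 by move=> e; move: k1; rewrite -e; lia.
    have xDv2 : x <> v.+2 by move=> e; move: k2; rewrite -e; lia.
    have l2 := lw v.+2.
    apply: (AK v x); [by rewrite mi mw; lia | by lia | |].
      by rewrite iv; have := ix' x; lia.
    by apply/succE; lia.
- split.
  + move=> x y z; rewrite mi mw => zw h1 h2.
    have : x \in w' by rewrite -index_mem; have := index_size z w'; lia.
    rewrite mi mw => h0.
    (* A new occurrence has [v] as its smallest letter, with letters on both sides of it. Hence [i]
       is the place of [v.+1], which comes right after [v] and can replace it, giving an occurrence
       in [w]. *)
    have [xv | xDv] := eqVneq x v.
      move: h2; rewrite xv iv gtvE ?ltvE; try lia.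
      have lz := lw z; have iz := inj z v.+1.
      have [-> | yDv1] := eqVneq y v.+1; first lia.
      by have := A3 v.+1 y z; rewrite mw; lia.
    rewrite !ltE in h2; try lia.
    by apply: (A3 x y z) => //; rewrite mw; lia.
  + move=> x y z t; rewrite mi mw => yw h1 h2 h3.
    have : x \in w' by rewrite -index_mem; have := index_size y w'; lia.
    rewrite mi mw => h0; move: h3.
    have [xv | xDv] := eqVneq x v.
      rewrite xv iv gtvE ?ltvE ?ltE; try lia.
      have ly := lw y; have lz := lw z; have iz := inj z v.+1.
      have [-> | yDv1] := eqVneq y v.+1; first by have := lw v.+1; lia.
      by have := A4 v.+1 y z t; rewrite mw; lia.
    rewrite !ltE; try lia.
    by apply: (A4 x y z t) => //; rewrite ?mw; lia.
  + move=> a b; rewrite mi mw => bw h1 h2 h3.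
    have : a \in w' by rewrite -index_mem; have := index_size b w'; lia.
    rewrite mi mw => h0.
    have [k1 k2] : index a.+2 w = (index a.+1 w).+1 /\ i <> index a.+2 w.
      by apply/succE; lia.
    have [av | aDv] := eqVneq a v; last first.
      have [k3 k4] : index b w = (index a w).+1 /\ i <> index b w.
        by apply/succE; lia.
      by apply: (AK a b); rewrite ?mw //; lia.
    (* The letter after [v] is [b], above [v.+2]. So [i] is neither the end nor the place of [v.+1],
       and at the front [Hi] would put [v.+1], not [b], first. *)
    have qb : index b w = i by move: h2; rewrite av iv; have := ix' b; lia.
    rewrite av in k1 k2 *; rewrite /keeps k1 eqxx andbT in Hi.
    by have := inj b v.+1; have := lw b; lia.
Qed.

(** * Counting the words *)

Fixpoint good_words v m : seq (seq nat) :=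
  if m isn't m'.+1 then [:: [:: v]]
  else [seq insat i v w | w <- good_words v.+1 m', i <- slots v.+1 w].

Lemma slots_le (i v : nat) (w : seq nat) : i \in slots v w -> i <= size w.
Proof.
rewrite inE mem_cat; case/or3P; [by move/eqP-> | |].
  by case: keeps => //; rewrite inE => /eqP->.
by case: eqP => // _; rewrite inE => /eqP->; rewrite index_size.
Qed.

Lemma slots_uniq (v : nat) (w : seq nat) : v \in w -> uniq (slots v w).
Proof.
rewrite -index_mem /slots /=; case: keeps; case: (index v w) => [|j] /= lt_jw;
  by rewrite ?inE ?andbT //; lia.
Qed.

Lemma perm_iota_notin (v : nat) (w : seq nat) m : perm_eq w (iota v.+1 m) -> v \notin w.
Proof. by move/perm_mem->; rewrite mem_iota ltnn. Qed.

Lemma good1 v : good [:: v].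
Proof.
have i0 : index v [:: v] = 0 by rewrite /= eqxx.
by split=> [x y z|x y z t|a b]; rewrite inE => /eqP->; rewrite i0; lia.
Qed.

(** Induction by deleting the least letter: [good_insat] says that the rest is good and that the
    deleted letter stood at one of its slots. *)
Lemma mem_good_words v m w :
  reflect (perm_eq w (iota v m.+1) /\ good w) (w \in good_words v m).
Proof.
elim: m v w => [|m IHm] v w.
  rewrite inE; apply: (iffP eqP) => [->|[Pw _]]; first by split=> //; apply: good1.
  exact: perm_small_eq Pw.
apply: (iffP allpairsPdep) => [[w' [i [/IHm[Pw' Gw'] Hi ->]]] | [Pw Gw]].
  rewrite perm_insat; split=> //.
  by apply/(good_insat _ _ _ m); rewrite ?(slots_le _ _ _ Hi).
have vw : v \in w by rewrite (perm_mem Pw) mem_iota; lia.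
have Ew := insat_index_rem _ _ vw.
have Pr : perm_eq (rem v w) (iota v.+1 m.+1) by rewrite -(perm_insat (index v w)) Ew.
have le_iw : index v w <= size (rem v w).
  by rewrite size_rem // -ltnS prednK ?index_mem //; case: (w) vw.
move: Gw; rewrite -Ew => /(good_insat _ _ _ _ le_iw Pr)[Gr Hi].
by exists (rem v w), (index v w); split=> //; apply/IHm.
Qed.

(** No word arises twice: its least letter gives back the slot by [index] and the shorter word by
    [rem]. *)
Lemma good_words_uniq v m : uniq (good_words v m).
Proof.
elim: m v => [|m IHm] v //=.
pose proof (@allpairs_uniq_dep _ (fun=> nat) _ (fun w i => insat i v w)
  (good_words v.+1 m) (slots v.+1)) as AU; apply: AU => //.
  move=> w /mem_good_words[Pw _]; apply: slots_uniq.
  by rewrite (perm_mem Pw) mem_iota; lia.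
move=> p1 p2 /allpairsPdep[w1 [i1 [/mem_good_words[P1 _] H1 ->]]].
move=> /allpairsPdep[w2 [i2 [/mem_good_words[P2 _] H2 ->]]] /= e.
have [n1 n2] := (perm_iota_notin _ _ _ P1, perm_iota_notin _ _ _ P2).
have [l1 l2] := (slots_le _ _ _ H1, slots_le _ _ _ H2).
have ew : w1 = w2 by rewrite -(rem_insat _ _ _ l1 n1) e rem_insat.
have ei : i1 = i2 by rewrite -(index_insat_eq _ _ _ l1 n1) e index_insat_eq.
by rewrite ew ei.
Qed.

(** The words counted by S, which have two slots instead of three. *)
Definition flexible (v : nat) (w : seq nat) := (index v w == 0) || keeps v w.

Lemma size_slots (v : nat) (w : seq nat) : size (slots v w) + flexible v w = 3.
Proof.
rewrite /slots /flexible /= size_cat /keeps.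
by case: (index v w) => [|j] //=; case: eqP.
Qed.

(** At the end [v] has a letter before it and none after it; at any other slot it is in front or
    just before [v.+1]. *)
Lemma flexible_insat (i v : nat) (w : seq nat) : i <= size w -> v \notin w ->
  v.+1 \in w -> i \in slots v.+1 w -> flexible v (insat i v w) = (i != size w).
Proof.
move=> le_iw vw v1w; have lt_jw : index v.+1 w < size w by rewrite index_mem.
have vDv : v.+1 != v by lia.
rewrite /flexible /keeps index_insat_eq // index_insat //.
rewrite inE mem_cat; case: keeps; case: (index _ _) lt_jw => [|j] lt_jw;
  by rewrite /= ?in_nil ?mem_seq1 => H; case: leqP => H'; rewrite /= ?addn0 ?addn1; lia.
Qed.

Lemma good_wordsS v m : good_words v m.+1 =
  [seq insat i v w | w <- good_words v.+1 m, i <- slots v.+1 w].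
Proof. by []. Qed.

Lemma count_flexible v m : count (flexible v) (good_words v m.+1) =
   \sum_(w <- good_words v.+1 m) (size (slots v.+1 w)).-1.
Proof.
rewrite good_wordsS count_flatten sumnE big_map big_map; apply: eq_big_seq => w.
move=> /mem_good_words[Pw _]; rewrite count_map.
have vw := perm_iota_notin _ _ _ Pw.
have v1w : v.+1 \in w by rewrite (perm_mem Pw) mem_iota; lia.
rewrite (@eq_in_count _ _ (predC1 (size w))) => [|i Hi]; last first.
  exact: (flexible_insat i v w (slots_le _ _ _ Hi) vw v1w Hi).
(* The end is a slot listed exactly once, so excluding it lowers the count by one. *)
apply/eqP; rewrite -(eqn_add2l (count_mem (size w) (slots v.+1 w))).
by rewrite count_predC count_uniq_mem ?slots_uniq // mem_head.
Qed.

(** The second component is S = P(m+1) - P(m), written without subtraction. [E1] and [E2] give T' =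
    3 T - S, and [E3] gives S' = T' - T. *)
Lemma count_good_words v m :
  size (good_words v m) = pell m.+1 /\
  count (flexible v) (good_words v m) + pell m = pell m.+1.
Proof.
elim: m v => [|m IHm] v; first by rewrite /= /flexible /= eqxx.
have [sz ct] := IHm v.+1.
have E1 : size (good_words v m.+1) =
    \sum_(w <- good_words v.+1 m) size (slots v.+1 w).
  by rewrite good_wordsS size_allpairs_dep sumnE big_map.
have E2 : \sum_(w <- good_words v.+1 m) size (slots v.+1 w) +
    count (flexible v.+1) (good_words v.+1 m) = 3 * size (good_words v.+1 m).
  have -> : count (flexible v.+1) (good_words v.+1 m) =
      \sum_(w <- good_words v.+1 m) flexible v.+1 w.
    by rewrite -sum1_count big_mkcond.
  rewrite -big_split /= (eq_bigr (fun => 3)) => [|w _].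
    by rewrite big_const_seq count_predT iter_addn_0.
  exact: size_slots.
have E3 : count (flexible v) (good_words v m.+1) + size (good_words v.+1 m)
    = \sum_(w <- good_words v.+1 m) size (slots v.+1 w).
  rewrite count_flexible -sum1_size -big_split /=; apply: eq_bigr => w _.
  by rewrite addn1.
move: E1 E2 E3 ct; set s := \sum_(w <- _) _; rewrite sz.
set a := size _; set b := count _ _; set c := count _ _.
rewrite [pell m.+2]/(2 * pell m.+1 + pell m); lia.
Qed.

(** * Cycles as position functions *)

Definition cyc_ordered (i j k l : nat) : bool :=
  [|| [&& i < j, j < k & k < l], [&& j < k, k < l & l < i],
      [&& k < l, l < i & i < j] | [&& l < i, i < j & j < k]].

(** Here [p] gives positions on the cycle and [x], [y], [z], [t] play 1, 3, 2, 4; cyclic order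
    accounts for all cycle forms at once. *)
Definition avoids_cyc1324 (n : nat) (p : nat -> nat) := forall x y z t,
  x < z < y -> y < t < n -> ~~ cyc_ordered (p x) (p y) (p z) (p t).

Ltac cyc_ord := apply/or4P; first [apply: Or41; lia | apply: Or42; lia
  | apply: Or43; lia | apply: Or44; lia].

Section CycleOnNat.
Variables (n : nat) (f p : nat -> nat).
Hypothesis n_gt1 : 1 < n.
Hypothesis p_lt : forall x, x < n -> p x < n.
Hypothesis p_inj : forall x y, x < n -> y < n -> p x = p y -> x = y.
Hypothesis f_lt : forall x, x < n -> f x < n.
Hypothesis f_surj : forall y, y < n -> exists2 x, x < n & f x = y.
(** The map [f] moves one place along the cycle, wrapping around at the last position. *)
Hypothesis pf : forall x, x < n ->
  p (f x) = if (p x).+1 == n then 0 else (p x).+1.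

Lemma p_neq x y : x < n -> y < n -> x <> y -> p x <> p y.
Proof. by move=> xn yn xDy /p_inj; auto. Qed.

Lemma cyc_step x : x < n ->
  p x < n /\ (p (f x) = (p x).+1 \/ (p x).+1 = n /\ p (f x) = 0).
Proof. by move=> xn; rewrite pf // p_lt //; case: eqP => ?; split; lia. Qed.

Lemma cyc_inj x y : x < n -> y < n -> f x = f y -> x = y.
Proof.
move=> xn yn e; have := cyc_step x xn; have := cyc_step y yn; rewrite e.
by move=> hx hy; apply: p_inj => //; lia.
Qed.

Lemma cyc_no_fix x : x < n -> f x <> x.
Proof. by move=> xn e; have := cyc_step x xn; rewrite e; lia. Qed.

Lemma cyc_pigeonhole (a b : nat) (s : seq nat) : uniq s ->
  (forall x, x \in s -> x < n /\ a <= f x < b) -> size s <= b - a.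
Proof.
move=> Us Hs; rewrite -(size_iota a (b - a)) -(size_map f); apply: uniq_leq_size.
  by rewrite map_inj_in_uniq // => x y /Hs[? _] /Hs[? _]; apply: cyc_inj.
by move=> _ /mapP[x /Hs[_ h] ->]; rewrite mem_iota; lia.
Qed.

Hypothesis p0 : p 0 = 0.
Hypothesis avoid : avoids_cyc1324 n p.

(** Otherwise [f e' < f e < e < e']. As [f e] directly follows [e] and [f e'] directly follows [e']
    on the cycle, [f e'], [e], [f e], [e'] is a cyclic 1324. *)
Lemma antiexc_increasing e e' : e < e' < n -> f e < e -> f e' < e' -> f e < f e'.
Proof.
move=> he h h'; rewrite ltnNge leq_eqVlt; apply/norP; split.
  by apply/eqP=> /cyc_inj; lia.
apply/negP=> lt_f; have [hn hn'] : e < n /\ e' < n by lia.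
have [pe se] := cyc_step e hn; have [pe' se'] := cyc_step e' hn'.
have ? : p (f e') <> p e by apply: p_neq; lia.
have ? : p (f e) <> p e' by apply: p_neq; lia.
have ? : p e <> p e' by apply: p_neq; lia.
case/negP: (avoid (f e') e (f e) e' ltac:(lia) ltac:(lia)).
by case: se se' => [se|[? se]] [se'|[? se']]; case: (ltngtP (p e) (p e')) => // ?; cyc_ord.
Qed.

(** Suppose [a < f x]. If [f x < f a], then [x], [f x], [a], [f a] is a cyclic 1324. Otherwise the
    place of [a.+1] decides: on the arc from [x] to [a] it gives [x], [a.+1], [a], [f a]; on the arc
    from [f a] to [x] it gives [a], [f a], [a.+1], [f x]. *)
Lemma jump_bounds_earlier a x : x < a < n -> a.+1 < f a -> f x <= a.
Proof.
move=> hx ha; rewrite leqNgt; apply/negP=> lt_afx.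
have [hn hn'] : a < n /\ x < n by lia.
have [ha' hx'] := (f_lt a hn, f_lt x hn').
have [pa sa] := cyc_step a hn; have [px sx] := cyc_step x hn'.
have ? : p (f a) <> p x by apply: p_neq; lia.
have ? : p a <> p x by apply: p_neq; lia.
have ? : p (f x) <> p a by apply: p_neq; lia.
have fxDfa : f x <> f a by move/cyc_inj; lia.
have ? : p (f x) <> p (f a) by apply: p_neq; lia.
have [lt_fxa | lt_fax] : f x < f a \/ f a < f x by lia.
  case/negP: (avoid x (f x) a (f a) ltac:(lia) ltac:(lia)).
  by case: sx sa => [sx|[? sx]] [sa|[? sa]]; case: (ltngtP (p x) (p a)) => // ?; cyc_ord.
have ? : p a.+1 <> p x by apply: p_neq; lia.
have ? : p a.+1 <> p a by apply: p_neq; lia.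
have ? : p a.+1 <> p (f x) by apply: p_neq; lia.
have ? : p a.+1 <> p (f a) by apply: p_neq; lia.
have : p a.+1 < n by apply: p_lt; lia.
move=> ?; have av1 := avoid x a.+1 a (f a) ltac:(lia) ltac:(lia).
have av2 := avoid a (f a) a.+1 (f x) ltac:(lia) ltac:(lia).
by case: sx sa => [sx|[? sx]] [sa|[? sa]]; case: (ltngtP (p x) (p a)) => // ?;
  case: (ltngtP (p x) (p a.+1)) => // ?; case: (ltngtP (p a) (p a.+1)) => // ?;
  try lia; first [case/negP: av1; cyc_ord | case/negP: av2; cyc_ord].
Qed.

(** Suppose [a < x]; the cycle runs [x], [a], [f a]. If [x < f a], prefixing 0 gives a 1324.
    Otherwise [a.+1] yields one: [0], [a.+1], [a], [f a] if it precedes [a], and [a], [f a], [a.+1],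
    [x] if it follows. *)
Lemma jump_entered_from_below x a : x < n -> 0 < a -> f x = a ->
  a.+1 < f a -> x < a.
Proof.
move=> xn a_gt0 fx ha; rewrite ltnNge leq_eqVlt; apply/norP; split.
  by apply/eqP=> e; apply: (cyc_no_fix x xn); rewrite fx.
apply/negP=> lt_ax; have an : a < n by lia.
have fan := f_lt a an; have [pa sa] := cyc_step a an.
have [px sx] := cyc_step x xn; rewrite fx in sx.
have ? : p a <> 0 by rewrite -p0; apply: p_neq; lia.
have ? : p x <> 0 by rewrite -p0; apply: p_neq; lia.
have ? : p (f a) <> 0 by rewrite -p0; apply: p_neq; lia.
have fDx : f a <> x by move=> e; have : p (f a) = p x; [rewrite e|lia].
have ? : p (f a) <> p x by apply: p_neq; lia.
have [lt_xfa | lt_fax] : x < f a \/ f a < x by lia.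
  have := avoid 0 x a (f a) ltac:(lia) ltac:(lia); rewrite p0.
  by case/negP; case: sx sa => [sx|[? sx]] [sa|[? sa]]; try lia; cyc_ord.
have ? : p a.+1 <> 0 by rewrite -p0; apply: p_neq; lia.
have ? : p a.+1 <> p x by apply: p_neq; lia.
have ? : p a.+1 <> p a by apply: p_neq; lia.
have ? : p a.+1 <> p (f a) by apply: p_neq; lia.
have : p a.+1 < n by apply: p_lt; lia.
move=> ?; have av1 := avoid 0 a.+1 a (f a) ltac:(lia) ltac:(lia).
have av2 := avoid a (f a) a.+1 x ltac:(lia) ltac:(lia); rewrite p0 in av1.
by case: sx sa => [sx|[? sx]] [sa|[? sa]]; case: (ltngtP (p a) (p a.+1)) => // ?;
  try lia; first [case/negP: av1; cyc_ord | case/negP: av2; cyc_ord].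
Qed.

Lemma cyc_2431 :
  (exists i j k l, [/\ i < j < k, k < l < n, f l < f i < f k & f k < f j]) <->
  (exists a, [/\ 0 < a, a.+1 < n, f a.+1 = a.+2 & a.+2 < f a]).
Proof.
split=> [[q [a [b [e [h1 h2 h3 h4]]]]] | [a [a_gt0 a1n fa1 fa]]].
  (* Otherwise [b] and [e] would both have smaller images, in decreasing order. So [b < f b < f a],
     and [a] is a jump. *)
  have lt_b : b < f b.
    have := antiexc_increasing b e; have := cyc_no_fix b; lia.
  have fq : f q <= a by apply: jump_bounds_earlier; lia.
  have fa1 : f a.+1 <= a.+2.
    by rewrite leqNgt; apply/negP=> /(jump_bounds_earlier a.+1 a); lia.
  have [fa1E | fa1D] := eqVneq (f a.+1) a.+2.
    by exists a; split=> //; have := cyc_inj a a.+1; lia.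
  have lt_fa1 : f a.+1 <= a by have := cyc_no_fix a.+1; lia.
  (* The [a.+2] arguments [0], ..., [a.-1], [a.+1], [e] would all have images among the [a.+1]
     values up to [a]. *)
  have := cyc_pigeonhole 0 a.+1 (a.+1 :: e :: iota 0 a).
  rewrite /= size_iota subn0 ltnn => H; suff: false by []; apply: H.
    by rewrite iota_uniq !inE !mem_iota; lia.
  move=> x; rewrite !inE mem_iota => /or3P[/eqP->|/eqP->|lt_xa]; try lia.
  by have := jump_bounds_earlier a x; lia.
have [q qn fq] : exists2 x, x < n & f x = a by apply: f_surj; lia.
have lt_qa : q < a by apply: jump_entered_from_below; lia.
(* The preimage [q] of [a] plays the 2, so an [e] beyond [a.+1] with image below [a] completes 2431.
   Without one, [q] and all arguments from [a] on inject into the values from [a] on, one too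
   few. *)
have [/hasP[e] | /hasPn no] := boolP (has (fun e => f e < a) (iota a.+2 (n - a.+2))).
  by rewrite mem_iota => he lt_e; exists q, a, a.+1, e; split; lia.
have := cyc_pigeonhole a n (q :: a :: a.+1 :: iota a.+2 (n - a.+2)).
rewrite /= size_iota => H; suff: false by []; have {H} := H _ _.
move=> H; have: (n - a.+2).+2 < n - a; last lia; apply: H.
  by rewrite iota_uniq !inE !mem_iota; lia.
move=> x; rewrite !inE => /or4P[/eqP->|/eqP->|/eqP->|x_in].
- by rewrite fq; lia.
- by have := f_lt a; lia.
- by have := f_lt a.+1; lia.
- by have := no x x_in; move: x_in; rewrite mem_iota; have := f_lt x; lia.
Qed.

End CycleOnNat.

(** If 0 plays the 1, then 324 remains, a 213 in [w]. Otherwise [w] contains a rotation of 1324: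
    1324, 3241 and 2413 contain 213, and the remaining one is 4132. *)
Lemma avoids_cyc1324P n (w : seq nat) : perm_eq w (iota 1 n) ->
  avoids_cyc1324 n.+1 (index^~ (0 :: w)) <-> avoids213 w /\ avoids4132 w.
Proof.
move=> Pw; have mw (x : nat) : (x \in w) = (0 < x <= n).
  by rewrite (perm_mem Pw) mem_iota; lia.
have lw (x : nat) : (index x w < size w) = (0 < x <= n) by rewrite index_mem.
have i0 : index 0 (0 :: w) = 0 by [].
have iS (x : nat) : 0 < x -> index x (0 :: w) = (index x w).+1 by case: x.
split=> [av | [A3 A4] x y z t h1 h2].
  split=> [x y z zw h1 h2 | x y z t yw h1 h2 h3].
    rewrite mw in zw; have ? : 0 < x by have := lw x; have := lw z; lia.
    have := av 0 y x z; rewrite i0 !iS /cyc_ordered; lia.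
  rewrite mw in yw; have ? : 0 < x by have := lw x; have := lw y; lia.
  have lt := lw t; have ly := lw y; have lz := lw z.
  case/negP: (av x z y t ltac:(lia) ltac:(lia)).
  by rewrite !iS; try lia; apply/or4P; apply: Or44; lia.
have [x0 | x_gt0] := posnP x.
  apply/negP; rewrite x0 i0 !iS; try lia.
  by have := A3 z y t; rewrite mw => H /or4P[]; lia.
apply/negP; rewrite !iS; try lia.
have yw : y \in w by rewrite mw; lia.
have zw : z \in w by rewrite mw; lia.
have tw : t \in w by rewrite mw; lia.
case/or4P => ?.
- by apply: (A3 z y t) => //; lia.
- by apply: (A3 z y t) => //; lia.
- by apply: (A3 x z y) => //; lia.
- by apply: (A4 x z y t) => //; lia.
Qed.

(** * Patterns in terms of positions *)

Definition pair_like (w tau : seq nat) (i s j t : nat) : bool :=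
  (nth 0 w i > nth 0 w j) == (nth 0 tau s > nth 0 tau t).

(** Replaces the finite function by four explicit positions, so that order conditions become linear
    arithmetic. *)
Lemma contains4P (tau w : seq nat) : size tau = 4 -> contains tau w <->
  exists i j k l, [/\ [&& i < j, j < k, k < l & l < size w],
    pair_like w tau i 0 j 1 && pair_like w tau i 0 k 2,
    pair_like w tau i 0 l 3 && pair_like w tau j 1 k 2 &
    pair_like w tau j 1 l 3 && pair_like w tau k 2 l 3].
Proof.
case: tau => [|a [|b [|c [|d []]]]] // _; split.
  case/existsP=> f /forallP H.
  have {}H (s t : 'I_4) : s < t -> (f s < f t) &&
      pair_like w [:: a; b; c; d] (f s) s (f t) t.
    by move=> lt_st; have /forallP/(_ t)/implyP/(_ lt_st) := H s.
  pose o i (lt_i : i < 4) : 'I_4 := Ordinal lt_i.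
  have /andP[l01 H01] := H (o 0 isT) (o 1 isT) isT.
  have /andP[l02 H02] := H (o 0 isT) (o 2 isT) isT.
  have /andP[l03 H03] := H (o 0 isT) (o 3 isT) isT.
  have /andP[l12 H12] := H (o 1 isT) (o 2 isT) isT.
  have /andP[l13 H13] := H (o 1 isT) (o 3 isT) isT.
  have /andP[l23 H23] := H (o 2 isT) (o 3 isT) isT.
  exists (f (o 0 isT)), (f (o 1 isT)), (f (o 2 isT)), (f (o 3 isT)).
  by split; rewrite ?l01 ?l12 ?l23 ?ltn_ord //; apply/andP; split.
case=> i [j [k [l [/and4P[lij ljk lkl lw] /andP[H01 H02] /andP[H03 H12] /andP[H13 H23]]]]].
have [lkw ljw liw] : [/\ k < size w, j < size w & i < size w] by split; lia.
pose s0 := Ordinal liw.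
pose s := [:: s0; Ordinal ljw; Ordinal lkw; Ordinal lw].
apply/existsP; exists [ffun x => nth s0 s (val x)].
apply/forallP=> x; apply/forallP=> y; apply/implyP; rewrite !ffunE.
case: x y => [[|[|[|[|//]]]] hx] [[|[|[|[|//]]]] hy] //= _;
  apply/andP; split=> //; lia.
Qed.

Lemma contains1324P (v : seq nat) : uniq v ->
  contains [:: 1; 3; 2; 4] (map S v) <->
  exists x y z t, [/\ x < z < y, y < t, t \in v &
    [&& index x v < index y v, index y v < index z v & index z v < index t v]].
Proof.
move=> Uv; rewrite contains4P // size_map; split.
  case=> i [j [k [l [/and4P[lij ljk lkl lv] H1 H2 H3]]]].
  have [lk lj li] : [/\ k < size v, j < size v & i < size v] by split; lia.
  move: H1 H2 H3; rewrite /pair_like !(nth_map 0) //= => H1 H2 H3.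
  have neq a b : a < b -> b < size v -> nth 0 v a <> nth 0 v b.
    by move=> ab bv /eqP; rewrite nth_uniq ?(ltn_trans ab bv) // ltn_eqF.
  have := neq _ _ lij lj; have := neq _ _ ljk lk; have := neq _ _ lkl lv.
  have := neq i k; have := neq i l; have := neq j l => N1 N2 N3 N4 N5 N6.
  exists (nth 0 v i), (nth 0 v j), (nth 0 v k), (nth 0 v l).
  by split; rewrite ?mem_nth ?index_uniq //; lia.
case=> x [y [z [t [h1 h2 tv /and3P[o1 o2 o3]]]]].
have mE (u : nat) : (u \in v) = (index u v < size v) by rewrite index_mem.
have lt : index t v < size v by rewrite index_mem.
have [xv yv zv] : [/\ x \in v, y \in v & z \in v] by rewrite !mE; split; lia.
exists (index x v), (index y v), (index z v), (index t v); split; first lia.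
all: by rewrite /pair_like !(nth_map 0) ?index_mem // !nth_index //=; lia.
Qed.

Lemma index_rot r (v : seq nat) x : uniq v -> r <= size v -> x \in v ->
  index x (rot r v) =
  if index x v < r then index x v + (size v - r) else index x v - r.
Proof.
move=> Uv le_rv xv; have xv' : x \in take r v ++ drop r v by rewrite cat_take_drop.
have := Uv; rewrite -{1}(cat_take_drop r v) cat_uniq => /and3P[_ /hasPn dis _].
have szt : size (take r v) = r by rewrite size_takel.
have -> : index x v = index x (take r v ++ drop r v) by rewrite cat_take_drop.
rewrite /rot !index_cat size_drop szt.
move: xv'; rewrite mem_cat; have [xt _ | xt /= xd] := boolP (x \in take r v).
  have -> : (x \in drop r v) = false by apply/negP=> /dis/negP[].
  have lt_r : index x (take r v) < r by rewrite -{2}szt index_mem.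
  by rewrite /= lt_r addnC.
by rewrite xd /= ltnNge leq_addr /= addKn.
Qed.

Lemma avoids_rotationsP n (v : seq nat) : perm_eq v (iota 0 n) ->
  (forall r, r < n -> avoids [:: 1; 3; 2; 4] (map S (rot r v))) <->
  avoids_cyc1324 n (index^~ v).
Proof.
move=> Pv; have sv : size v = n by rewrite (perm_size Pv) size_iota.
have mv (x : nat) : (x \in v) = (x < n) by rewrite (perm_mem Pv) mem_iota; lia.
have Uv : uniq v by rewrite (perm_uniq Pv) iota_uniq.
have lv (x : nat) : x < n -> index x v < n by rewrite -mv -sv index_mem.
split=> [av x y z t h1 h2 | av r lt_rn].
  have xn : x < n by lia.
  (* The rotation that starts at [x] turns the cyclic order into a linear one. *)
  have := av (index x v) (lv x xn); apply: contraNN => cyc.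
  apply/contains1324P; first by rewrite rot_uniq.
  have := lv x xn; have := lv t ltac:(lia); have := lv y ltac:(lia).
  have := lv z ltac:(lia) => ? ? ? ?.
  exists x, y, z, t; split; rewrite ?mem_rot ?mv; try lia.
  rewrite !index_rot ?mv ?sv //; try lia.
  by case/or4P: cyc => ?; do ![case: ifP; try lia].
apply/negP=> /contains1324P[|x [y [z [t [h1 h2]]]]]; first by rewrite rot_uniq.
rewrite mem_rot mv => tn; rewrite !index_rot ?mv ?sv ?(ltnW lt_rn) //; try lia.
have := lv x ltac:(lia); have := lv t ltac:(lia); have := lv y ltac:(lia).
have := lv z ltac:(lia) => ? ? ? ? H.
case/negP: (av x y z t ltac:(lia) ltac:(lia)).
by move: H; do 4!case: ifP => ?; move=> H; cyc_ord.
Qed.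

(** * The cycle word of a permutation *)

Lemma orbit_of_fcycle (T : finType) (f : T -> T) (x : T) (c : seq T) :
  fcycle f (x :: c) -> uniq (x :: c) -> fingraph.orbit f x = x :: c.
Proof.
move=> Cc Uc; rewrite /fingraph.orbit (order_cycle Cc Uc (mem_head _ _)) /=.
move: Cc; rewrite /= rcons_path => /andP[/fpathE-> _].
by rewrite size_traject.
Qed.

Lemma mem_full_seq n (c : seq 'I_n) x : uniq c -> size c = n -> x \in c.
Proof.
move=> Uc sc; have e : #|c| = #|@predT 'I_n|.
  by rewrite (card_uniqP Uc) sc card_ord.
by rewrite (subset_cardP e (subset_predT _)).
Qed.

Section CyclicPerm.
Variables (n : nat) (pi : 'S_n.+1).

Definition cycle_word : seq nat := map val (fingraph.orbit pi ord0).

Lemma cyclic_permE : cyclic_perm pi = (fingraph.order pi ord0 == n.+1).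
Proof.
apply/existsP/eqP => [[c /andP[Uc Cc]] | o].
  have c0 : ord0 \in val c.
    apply: mem_full_seq => //.
    by rewrite size_tuple.
  by rewrite (order_cycle Cc Uc c0) size_tuple.
have sz : size (fingraph.orbit pi ord0) == n.+1 by rewrite size_orbit o.
exists (Tuple sz); rewrite /is_cycle_of /= orbit_uniq cycle_orbit //.
exact: perm_inj.
Qed.

Lemma cycle_word_cons : cycle_word = 0 :: behead cycle_word.
Proof. by rewrite /cycle_word /fingraph.orbit -orderSpred. Qed.

Hypothesis full : fingraph.order pi ord0 = n.+1.

Lemma mem_full_orbit x : x \in fingraph.orbit pi ord0.
Proof.
by apply: mem_full_seq; rewrite ?orbit_uniq ?size_orbit.
Qed.

Lemma perm_cycle_word : perm_eq cycle_word (iota 0 n.+1).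
Proof.
apply: uniq_perm; rewrite ?iota_uniq ?(map_inj_uniq val_inj) ?orbit_uniq // => x.
rewrite mem_iota; apply/mapP/idP => [[y _ ->] | lt_xn]; first exact: ltn_ord.
by exists (Ordinal lt_xn); rewrite ?mem_full_orbit.
Qed.

(** [inord] inverts [val] only below [n.+1]. *)
Definition nat_fun (a : nat) : nat := pi (inord a).

Lemma index_nat_fun a : a < n.+1 -> index (nat_fun a) cycle_word =
  if (index a cycle_word).+1 == n.+1 then 0 else (index a cycle_word).+1.
Proof.
move=> lt_an; rewrite -{2 3}(inordK lt_an) /nat_fun.
move: (inord a) => {lt_an}x.
rewrite /cycle_word !(index_map val_inj) -!/(findex pi ord0 _).
have cx : fconnect pi ord0 x by rewrite fconnect_orbit mem_full_orbit.
have -> : pi x = iter (findex pi ord0 x).+1 pi ord0 by rewrite iterS iter_findex.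
have := findex_max cx; rewrite full; set k := findex _ _ x; case: eqP => [-> _ | kD lt_k].
  by have := iter_order (@perm_inj _ pi) ord0; rewrite full => ->; rewrite findex0.
by rewrite findex_iter // full; lia.
Qed.

(** All tuples representing the cycle are rotations of one another, so the rotations of [cycle_word]
    are all the cycle forms. *)
Lemma cycle_formsP (tau : seq nat) :
  [forall c : n.+1.-tuple 'I_n.+1,
     is_cycle_of pi c ==> all (avoids tau) (cycle_forms c)] <->
  (forall r, r < n.+1 -> avoids tau (map S (rot r cycle_word))).
Proof.
have wE (i : nat) (c : seq 'I_n.+1) : word (rot i c) = map S (rot i (map val c)).
  by rewrite -map_rot -map_comp.
split=> [/forallP H r lt_r | H].
  have sz : size (fingraph.orbit pi ord0) == n.+1 by rewrite size_orbit full.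
  have cyc : is_cycle_of pi (Tuple sz).
    rewrite /is_cycle_of /= orbit_uniq cycle_orbit //; exact: perm_inj.
  have av := implyP (H (Tuple sz)) cyc; apply: (allP av); apply/mapP.
  by exists r; rewrite ?mem_iota // wE.
apply/forallP=> c; apply/implyP=> /andP[Uc Cc]; apply/allP=> _ /mapP[i _ ->].
have := size_rot i c; rewrite size_tuple.
have := Uc; rewrite -(rot_uniq i); have := Cc; rewrite -(rot_cycle i).
case Ec: (rot i c) => [|x c'] // Cc' Uc' _.
have [j Ej] := orbit_rot_cycle (cycle_orbit (@perm_inj _ pi) ord0)
  (orbit_uniq _ _) (mem_full_orbit x).
rewrite -(orbit_of_fcycle _ _ _ _ Cc' Uc') Ej wE -/cycle_word.
have [lt_j | le_j] := ltnP j n.+1; first exact: H.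
(* The rotation amount [j] comes without a bound; an oversized one acts as the identity. *)
rewrite rot_oversize ?size_map ?size_orbit ?full //.
by have := H 0 isT; rewrite rot0.
Qed.

Lemma contains2431P : contains [:: 2; 4; 3; 1] (one_line pi) <->
  exists i j k l, [/\ i < j < k, k < l < n.+1,
    nat_fun l < nat_fun i < nat_fun k & nat_fun k < nat_fun j].
Proof.
have szE : size (one_line pi) = n.+1 by rewrite 2!size_map size_enum_ord.
rewrite contains4P // szE.
have nthE i : i < n.+1 -> nth 0 (one_line pi) i = (nat_fun i).+1.
  move=> lt_in; rewrite /one_line /word -map_comp (nth_map ord0) ?size_enum_ord //=.
  by rewrite -{1}(inordK lt_in) nth_ord_enum.
have neq a b : a < b -> b < n.+1 -> nat_fun a <> nat_fun b.
  move=> lt_ab lt_b /val_inj/perm_inj/(congr1 val); rewrite /= !inordK; lia.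
split=> [[i [j [k [l [/and4P[lij ljk lkl ln] H1 H2 H3]]]]] |
         [i [j [k [l [h1 h2 h3 h4]]]]]].
  have [lk lj li] : [/\ k < n.+1, j < n.+1 & i < n.+1] by split; lia.
  move: H1 H2 H3; rewrite /pair_like !nthE //= => H1 H2 H3.
  have := neq _ _ lij lj; have := neq _ _ ljk lk; have := neq _ _ lkl ln.
  have := neq i k; have := neq i l; have := neq j l => N1 N2 N3 N4 N5 N6.
  by exists i, j, k, l; split; lia.
exists i, j, k, l; split; first lia.
all: by rewrite /pair_like !nthE //=; lia.
Qed.

End CyclicPerm.

(** * Cyclic avoiders correspond to good words *)

Section FullCycle.
Variables (n : nat) (pi : 'S_n.+2).
Hypothesis full : fingraph.order pi ord0 = n.+2.
Let w := behead (cycle_word _ pi).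
Let cwE : cycle_word _ pi = 0 :: w := cycle_word_cons _ pi.

Lemma perm_behead_cycle_word : perm_eq w (iota 1 n.+1).
Proof. by have := perm_cycle_word _ _ full; rewrite cwE perm_cons. Qed.

Lemma avoids_jump_step_cycle : avoids_jump_step w <->
  ~ exists a, [/\ 0 < a, a.+1 < n.+2, nat_fun _ pi a.+1 = a.+2 &
                 a.+2 < nat_fun _ pi a].
Proof.
have mw (x : nat) : (x \in w) = (0 < x < n.+2).
  by rewrite (perm_mem perm_behead_cycle_word) mem_iota; lia.
have sw : size w = n.+1 by rewrite (perm_size perm_behead_cycle_word) size_iota.
have lw (x : nat) : (index x w < n.+1) = (0 < x < n.+2).
  by rewrite -mw -index_mem sw.
have fn a : nat_fun _ pi a < n.+2 by apply: ltn_ord.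
(* Between nonzero letters, adjacency in [w] is application of the permutation; the last letter of
   [w] is the one sent to 0. *)
have fE a b : 0 < a < n.+2 -> 0 < b < n.+2 ->
    nat_fun _ pi a = b <-> index b w = (index a w).+1.
  move=> ha hb; have := index_nat_fun _ _ full a; rewrite cwE.
  have iS (x : nat) : 0 < x -> index x (0 :: w) = (index x w).+1 by case: x.
  have [a0 b0] : 0 < a /\ 0 < b by lia.
  rewrite (iS a a0) => /(_ ltac:(lia)) H; have la := lw a; have lb := lw b.
  split=> [fab | iab].
    by move: H; rewrite fab (iS b b0); case: eqP; lia.
  have f0 : 0 < nat_fun _ pi a.
    rewrite lt0n; apply/eqP=> f0; move: H; rewrite f0 /=.
    by case: eqP => [e|]; lia.
  move: H; rewrite iS // => H.
  have e : index (nat_fun _ pi a) w = index b w by move: H; case: eqP; lia.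
  have faw : nat_fun _ pi a \in w by rewrite mw f0 fn.
  have bw : b \in w by rewrite mw.
  by rewrite -(nth_index 0 faw) e nth_index.
split=> [LK [a [a0 an e1 lt_a]] | no a b bw ab iab ia2].
  have fa := fn a.
  by apply: (LK a (nat_fun _ pi a)); [rewrite mw | | apply/fE | apply/fE]; lia.
rewrite mw in bw; have := lw a; have := lw b => lb la.
apply: no; exists a; split; try lia; first by apply/fE; lia.
have -> : nat_fun _ pi a = b by apply/fE; lia.
by [].
Qed.

Lemma mem_cyclic_avoiders :
  pi \in cyclic_avoiders n.+2 [:: 2; 4; 3; 1] [:: 1; 3; 2; 4] <-> good w.
Proof.
have Pw := perm_behead_cycle_word.
have Pc := perm_cycle_word _ _ full.
have mc (x : nat) : (x \in cycle_word _ pi) = (x < n.+2).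
  by rewrite (perm_mem Pc) mem_iota.
have sc : size (cycle_word _ pi) = n.+2 by rewrite (perm_size Pc) size_iota.
(* [cyc_2431] assumes cyclic avoidance of 1324, hence the premise. *)
have patE : avoids_cyc1324 n.+2 (index^~ (cycle_word _ pi)) ->
    avoids [:: 2; 4; 3; 1] (one_line pi) <-> avoids_jump_step w.
  move=> av; rewrite avoids_jump_step_cycle.
  have fE : _ <-> _ := cyc_2431 n.+2 (nat_fun _ pi) (index^~ (cycle_word _ pi))
    isT _ _ _ _ (index_nat_fun _ _ full) _ av.
  rewrite -fE.
  - split=> [/negP no E | no]; first by apply/no/contains2431P.
    by apply/negP=> /contains2431P/no.
  - by move=> x; rewrite -mc -sc index_mem.
  - move=> x y; rewrite -mc -mc => xc yc e.
    by rewrite -(nth_index 0 xc) e nth_index.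
  - by move=> x _; apply: ltn_ord.
  - move=> y lt_y; exists (val ((pi^-1)%g (inord y))); first exact: ltn_ord.
    by rewrite /nat_fun inord_val permKV inordK.
  - by rewrite cwE.
have cycE : avoids_cyc1324 n.+2 (index^~ (cycle_word _ pi)) <->
    avoids213 w /\ avoids4132 w.
  by rewrite cwE; apply: avoids_cyc1324P.
rewrite inE cyclic_permE full eqxx /=; split.
  case/andP=> av2431 /(cycle_formsP _ _ full)/(avoids_rotationsP _ _ Pc) av.
  by have /cycE[] := av; split=> //; apply/(patE av).
case=> A3 A4 ALK; have av : avoids_cyc1324 n.+2 (index^~ (cycle_word _ pi)).
  by apply/cycE.
apply/andP; split; first exact/(patE av).
by apply/(cycle_formsP _ _ full)/(avoids_rotationsP _ _ Pc).
Qed.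

End FullCycle.

(** A permutation sends each letter of an orbit to the next one, and the common orbit contains every
    letter. *)
Lemma cycle_word_inj n (s t : 'S_n.+1) : fingraph.order s ord0 = n.+1 ->
  cycle_word _ s = cycle_word _ t -> s = t.
Proof.
move=> full /(inj_map val_inj) e; apply/permP=> x.
have nextE (u : 'S_n.+1) : x \in fingraph.orbit u ord0 ->
    u x = next (fingraph.orbit u ord0) x.
  move=> xu; have Cu := cycle_orbit (@perm_inj _ u) ord0.
  exact: eqP (next_cycle Cu xu).
have xs := mem_full_orbit _ _ full x.
by rewrite !nextE ?e // -e.
Qed.

Lemma perm_of_cycle_word n (w : seq nat) : perm_eq w (iota 1 n) ->
  exists2 s : 'S_n.+1, fingraph.order s ord0 = n.+1 & cycle_word _ s = 0 :: w.
Proof.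
move=> Pw; pose c : seq 'I_n.+1 := ord0 :: map inord w.
have valc : map val c = 0 :: w.
  rewrite /= -map_comp; congr (_ :: _); rewrite -[RHS]map_id.
  apply/eq_in_map => x; rewrite (perm_mem Pw) mem_iota => /= hx.
  by rewrite inordK; lia.
have Uc : uniq c.
  rewrite -(map_inj_uniq val_inj) valc /= (perm_uniq Pw) iota_uniq.
  by rewrite (perm_mem Pw) mem_iota.
(* The permutation is [next c], injective because [prev c] undoes it. *)
pose s := perm (can_inj (prev_next Uc)).
have Cc : fcycle s c.
  by rewrite (eq_cycle (e' := frel (next c))) ?cycle_next // => x y; rewrite /= permE.
have sc : size c = n.+1 by rewrite /= size_map (perm_size Pw) size_iota.
exists s; first by rewrite (order_cycle Cc Uc) ?mem_head.
by rewrite /cycle_word (orbit_of_fcycle _ _ _ _ Cc Uc).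
Qed.

Lemma card_cyclic_avoiders n :
  #|cyclic_avoiders n.+2 [:: 2; 4; 3; 1] [:: 1; 3; 2; 4]| = pell n.+1.
Proof.
set A := cyclic_avoiders _ _ _.
pose W (s : 'S_n.+2) := behead (cycle_word _ s).
have fullA s : s \in A -> fingraph.order s ord0 = n.+2.
  by rewrite inE cyclic_permE => /and4P[_ /eqP].
have injW : {in enum A &, injective W}.
  move=> s t; rewrite mem_enum => /fullA full _ e.
  by apply: cycle_word_inj full _; rewrite cycle_word_cons [RHS]cycle_word_cons -/(W s) e.
rewrite -(count_good_words 1 n).1 cardE -(size_map W); apply: perm_size.
apply: uniq_perm; first by rewrite map_inj_in_uniq ?enum_uniq.
  exact: good_words_uniq.
move=> w; apply/mapP/mem_good_words => [[s] | [Pw Gw]].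
  rewrite mem_enum => sA ->; have full := fullA s sA.
  by split; [apply: perm_behead_cycle_word | apply/mem_cyclic_avoiders].
have [s full cw] := perm_of_cycle_word _ _ Pw.
have ws : W s = w by rewrite /W cw.
by exists s => //; rewrite mem_enum; apply/mem_cyclic_avoiders; rewrite -/(W s) ?ws.
Qed.

Theorem theorem1p2 (n : nat) (hn : 0 < n) :
  #|cyclic_avoiders n [:: 2; 4; 3; 1] [:: 1; 3; 2; 4]| = pell (n - 1).
Proof.
case: n hn => [|[|n]] // _; last by rewrite card_cyclic_avoiders subn1.
(* For [n = 1] the guard [1 < n] empties the set, in accordance with P(0) = 0. *)
by rewrite -[RHS](cards0 'S_1); congr #|pred_of_set _|; apply/setP=> s; rewrite !inE.
Qed.
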